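(* Let $k\ge 3$ and $g\ge 5$ and let $G$ be a $(k,g)$-graph with $|G|<2\,b_2(k,g,(k-2)g)$. Then $G$ is cyclically $(k-2)g$-edge-connected, and every cycle-separating edge-cut of $G$ consisting of $(k-2)g$ edges separates $G$ into two components one of which is a cycle of length $g$.
   Context: A $(k,g)$-graph is a $k$-regular (simple) graph of girth $g$. An edge-cut is cycle-separating if its removal leaves at least two components containing a cycle; a graph is cyclically $c$-edge-connected if it has no cycle-separating edge-cut with fewer than $c$ edges. Moore bound: $M(k,2d+1)=\frac{k(k-1)^d-2}{k-2}$, $M(k,2d+2)=\frac{2(k-1)^{d+1}-2}{k-2}$. For $g=2d+1$ define $P_{k,g,s}(n)=n^2-M(k,g)n+\frac{s(dk-2d-1)(k-1)^d+s}{(k-2)^2}$; for $g=2d+2$ define $P_{k,g,s}(n)=kn^2-(kM+s)n+Ms+2s\cdot\frac{(dk-2d-1)(k-1)^{d+1}+k-1}{(k-2)^2}$ with $M=M(k,g)$. Let $v(k,g,s)=\frac12M(k,g)$ for odd $g$ and $\frac12M(k,g)+\frac{s}{2k}$ for even $g$. If $P_{k,g,s}$ has real roots, $b_1(k,g,s)\le b_2(k,g,s)$ denote them; otherwise $b_1=b_2=v(k,g,s)$. *)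

(* Defs.v *)
From HB Require Import structures.
From mathcomp Require Import all_boot all_order all_algebra.
From mathcomp Require Import polyrcf.

Set Implicit Arguments.
Unset Strict Implicit.
Unset Printing Implicit Defensive.

Import Order.TTheory GRing.Theory Num.Theory.

(* A finite simple graph on T is a symmetric irreflexive e : rel T. *)
Section Graphs.
Variables (T : finType) (e : rel T).

Definition regular (k : nat) : Prop := forall x, #|e x| = k.

(* The size bound excludes the degenerate ucycles [::], [:: x] and [:: x; y]. *)
Definition is_cycle (c : seq T) : bool := (2 < size c) && ucycleb e c.

Definition has_girth (g : nat) : Prop :=
  (exists2 c, is_cycle c & size c = g) /\ (forall c, is_cycle c -> g <= size c).

Definition edges : {set {set T}} :=
  [set [set p.1; p.2] | p : T * T & e p.1 p.2].

Definition components : {set {set T}} :=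
  equivalence_partition (connect e) [set: T].

Definition contains_cycle (A : {set T}) : Prop :=
  exists2 c, is_cycle c & {subset c <= A}.

(* The subgraph induced on A is a cycle of length g: there are no chords. *)
Definition induces_cycle (g : nat) (A : {set T}) : Prop :=
  exists c, [/\ is_cycle c, size c = g, A = [set x in c] &
    {in A &, forall x y, e x y = (y == next c x) || (x == next c y)}].

End Graphs.

Definition del_edges (T : finType) (e : rel T) (S : {set {set T}}) : rel T :=
  [rel x y | e x y && ([set x; y] \notin S)].

Section EdgeCuts.
Variables (T : finType) (e : rel T).

Definition edge_cut (S : {set {set T}}) : Prop :=
  S \subset edges e /\ 1 < #|components (del_edges e S)|.

Definition cycle_separating (S : {set {set T}}) : Prop :=
  exists A B, [/\ A \in components (del_edges e S),
    B \in components (del_edges e S), A != B,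
    contains_cycle (del_edges e S) A & contains_cycle (del_edges e S) B].

Definition cyclically_edge_connected (c : nat) : Prop :=
  forall S, edge_cut S -> cycle_separating S -> c <= #|S|.

Definition kg_graph (k g : nat) : Prop :=
  [/\ symmetric e, irreflexive e, regular e k & has_girth e g].

End EdgeCuts.

Local Open Scope ring_scope.

Section Bounds.
Variables (R : rcfType) (k g : nat).

(* The d such that g = 2d + 1 (g odd) or g = 2d + 2 (g even), for g > 0. *)
Definition half_girth : nat := (g.-1)./2.

Local Notation d := half_girth.
Local Notation K := (k%:R : R).

Definition moore : R :=
  if odd g then (K * (K - 1) ^+ d - 2) / (K - 2)
  else (2 * (K - 1) ^+ d.+1 - 2) / (K - 2).

Variable s : nat.

Local Notation M := moore.
Local Notation s' := (s%:R : R).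

Definition Ppoly : {poly R} :=
  if odd g then
    'X^2 - M *: 'X +
    ((s' * (d%:R * K - 2 * d%:R - 1) * (K - 1) ^+ d + s') / (K - 2) ^+ 2)%:P
  else
    K *: 'X^2 - (K * M + s') *: 'X +
    (M * s' + 2 * s' *
      (((d%:R * K - 2 * d%:R - 1) * (K - 1) ^+ d.+1 + K - 1) / (K - 2) ^+ 2))%:P.

Definition vbound : R :=
  if odd g then M / 2 else M / 2 + s' / (2 * K).

(* rootsR lists the distinct real roots in increasing order. A double root
   occurs once in it and is then both b1 and b2; without real roots both
   values are the default vbound. *)
Definition b1 : R := head vbound (rootsR Ppoly).
Definition b2 : R := last vbound (rootsR Ppoly).

End Bounds.

(* Main.v *)
Require Import Defs.
From mathcomp Require Import all_boot all_order all_algebra.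
From mathcomp Require Import reals.
From mathcomp Require Import polyrcf zify ring lra.

(* Counting the non-backtracking walks that start in a vertex set [H] and have
   length at most half the girth, all of which have distinct ends, shows that
   [P_{k,g,s} #|H|] is nonnegative whenever at most [s] edges leave [H]; so
   [#|H| >= b2] as soon as [#|H|] is at least the abscissa [vbound] of the vertex
   of [P], or at least some [y] with [P y < 0].
   Let [s = (k - 2) * g], and let [H] have more than [g] vertices and at most [s]
   leaving edges. A minimal subset of [H] with both properties has no vertex of
   degree at most [k / 2], and no two adjacent vertices of degree 2 when [k = 3]
   and [g >= 7], since deleting these would not increase the number of leaving
   edges. A Moore-type bound for this subset then reaches [vbound] or a [y] as
   above, so [#|H| >= b2]. As [#|T| < 2 * b2], of two disjoint sets with at least
   [g] vertices and at most [s] leaving edges, one has exactly [g] vertices, is a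
   chordless cycle, and has exactly [s] leaving edges. *)

Set Implicit Arguments.
Unset Strict Implicit.
Unset Printing Implicit Defensive.

Import Order.TTheory GRing.Theory Num.Theory.

(** * Non-backtracking walks *)

Section NonBacktrackingWalks.
Variables (T : finType) (f : rel T).
Hypotheses (f_sym : symmetric f) (f_irr : irreflexive f).

(* A walk [y :: p] that never backtracks and whose second vertex is not [x].
   Since [f] is irreflexive, [x = y] imposes no condition on the first step. *)
Fixpoint nbwalk (x y : T) (p : seq T) : bool :=
  if p is z :: p' then [&& f y z, z != x & nbwalk y z p'] else true.

Fixpoint nbwalks (d : nat) (x y : T) : seq (seq T) :=
  [::] :: if d is d'.+1 then
    [seq z :: p | z <- [seq z <- enum T | f y z && (z != x)], p <- nbwalks d' y z]
  else [::].

Lemma mem_nbwalks d x y p :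
  (p \in nbwalks d x y) = (size p <= d) && nbwalk x y p.
Proof.
elim: d x y p => [|d IH] x y [|z p] //=.
rewrite inE /= ltnS; apply/allpairsPdep/idP => [[w [q [+ + [-> ->]]]]|].
  rewrite mem_filter mem_enum IH => /andP[/andP[-> ->] _] /andP[-> ->] //.
case/and4P=> sp fyz zx wp; exists z, p.
by rewrite mem_filter mem_enum IH fyz zx sp wp.
Qed.

Lemma uniq_nbwalks d x y : uniq (nbwalks d x y).
Proof.
elim: d x y => [|d IH] x y //=; apply/andP; split.
  by apply/allpairsPdep => -[? [? []]].
apply: allpairs_uniq_dep => [|z _|[z p] [w q] _ _ /= [-> ->]] //.
by rewrite filter_uniq // enum_uniq.
Qed.

Lemma nbwalk_start x y p : nbwalk x y p -> nbwalk y y p.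
Proof.
case: p => //= z p /and3P[fyz _ ->]; rewrite fyz andbT /=.
by apply: contraTneq fyz => ->; rewrite f_irr.
Qed.

Lemma nbwalk_path x y p : nbwalk x y p -> path f y p.
Proof. by elim: p x y => //= z p IH x y /and3P[-> _ /IH]. Qed.

(** Dropping initial vertices leads to a start [y] that recurs in a duplicate-free rest. The segment
    up to that recurrence is a cycle. *)
Lemma nbwalk_cycle x y p : nbwalk x y p -> ~~ uniq (y :: p) ->
  exists2 c, is_cycle f c & size c <= size p.
Proof.
elim: p x y => //= z p IH x y /and3P[fyz zx wp].
have [/= Uzp|/= nU _] := boolP (uniq (z :: p)); last first.
  by have [c cc sc] := IH y z wp nU; exists c => //; apply: leqW.
rewrite Uzp andbT negbK inE => /predU1P[yz|yp].
  by move: fyz; rewrite yz f_irr.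
case/splitPr: yp wp Uzp => p1 p2 wp Uzp.
exists (y :: z :: p1); last by rewrite /= size_cat /= ltnS addnS ltnS leq_addr.
have pp := nbwalk_path wp; move: pp; rewrite cat_path /= => /and3P[pp1 fl _].
rewrite /is_cycle /ucycleb /= rcons_path fyz pp1 fl /=.
move: Uzp; rewrite -[_ && _]/(uniq ((z :: p1) ++ y :: p2)) cat_uniq /=.
case/and3P=> /andP[zp1 Up1] /norP[nn _] _.
rewrite inE negb_or zp1 Up1 /= andbT; apply/andP; split.
  (* An empty [p1] would make the walk return to [y] after one step, which is backtracking. *)
  by case: (p1) wp {IH pp1 fl zp1 Up1 nn} => //= /and3P[_]; rewrite eqxx.
by move: nn; rewrite inE negb_or.
Qed.

(** The walk [w] is [p] reversed, followed by [q]. It does not turn back at [x], since [q] does not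
    start towards [head x p]. The induction moves the first step of [p] to the front of [q]. *)
Lemma nbwalk_join u x p q : nbwalk u x p -> nbwalk (head x p) x q ->
  exists w, [/\ nbwalk (last x p) (last x p) w,
    last (last x p) w = last x q & size w = size p + size q].
Proof.
elim: p u x q => [|a p IH] u x q /=; first by move=> _ wq; exists q.
move=> /and3P[fxa au wp] wq.
have [|w [ww lw sw]] := IH x a (x :: q) wp.
  rewrite /= f_sym fxa wq andbT /=.
  case: p wp {IH} => /= [_|b p /and3P[_ bx _]]; last by rewrite eq_sym.
  by apply: contraTneq fxa => ->; rewrite f_irr.
by exists w; split=> //; rewrite sw /= addSnnS.
Qed.

Variable g : nat.
Hypothesis girth : forall c, is_cycle f c -> g <= size c.

Lemma nbwalk_closed x y p :
  nbwalk x y p -> last y p = y -> size p < g -> p = [::].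
Proof.
move=> wp lp sp; case: p wp lp sp => // a p wp lp sp.
have [|c /girth gc sc] := nbwalk_cycle wp.
  by rewrite /= -lp /= mem_last.
by move: (leq_trans gc sc); rewrite leqNgt sp.
Qed.

(** After stripping the common prefix, one walk reversed and joined to the other is a closed
    non-backtracking walk shorter than [g]. *)
Lemma nbwalk_inj x y p q : nbwalk x y p -> nbwalk x y q ->
  last y p = last y q -> size p + size q < g -> p = q.
Proof.
elim: p x y q => [|a p IH] x y [|b q] // wp wq lpq spq.
- by apply/esym/(nbwalk_closed wq).
- by apply/(nbwalk_closed wp); rewrite // addn0 in spq *.
have [eab|nab] := eqVneq a b.
  move: wp wq lpq; rewrite -eab /= => /and3P[_ _ wp] /and3P[_ _ wq] lpq.
  by rewrite (IH _ _ _ wp wq lpq) //; move: spq => /=; lia.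
have [|w [ww lw sw]] := nbwalk_join (q := b :: q) wp.
  by case/and3P: wq => fyb _ wq; rewrite /= fyb eq_sym nab.
move: (nbwalk_closed ww); rewrite lw lpq sw => /(_ erefl spq) w0.
by rewrite w0 in sw.
Qed.

Definition walk_count (P : {set T}) d x y :=
  count (fun p => last y p \in P) (nbwalks d x y).

Lemma walk_count0 P x y : walk_count P 0 x y = (y \in P).
Proof. by rewrite /walk_count /= addn0. Qed.

Lemma walk_countS P d x y : walk_count P d.+1 x y =
  (y \in P) + \sum_(z | f y z && (z != x)) walk_count P d y z.
Proof.
rewrite /walk_count /=; congr (_ + _).
rewrite count_flatten -map_comp sumnE big_map big_filter.
rewrite big_enum_cond /=; apply: eq_big => [z|z _] //=.
by rewrite count_map.
Qed.

Lemma walk_countC (P : {set T}) d x y :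
  walk_count P d x y + walk_count (~: P) d x y = walk_count setT d x y.
Proof.
elim: d x y => [|d IH] x y.
  by rewrite !walk_count0 !inE; case: (y \in P).
rewrite !walk_countS addnACA -big_split /= !inE; congr (_ + _).
  by case: (y \in P).
by apply: eq_bigr.
Qed.

Let uniq_ends (P : {set T}) (L : seq (seq T)) v :
  uniq L -> {in L &, injective (last v)} ->
  uniq [seq last v p | p <- L & last v p \in P].
Proof.
move=> UL injL; rewrite map_inj_in_uniq ?filter_uniq //.
by move=> p q; rewrite !mem_filter => /andP[_ pL] /andP[_ qL]; apply: injL.
Qed.

Lemma walk_count_vertex (P : {set T}) d v :
  d.*2 < g -> walk_count P d v v <= #|P|.
Proof.
move=> dg; rewrite /walk_count -size_filter -(size_map (last v)) cardE.
apply: uniq_leq_size => [|z /mapP[p]]; last first.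
  by rewrite mem_filter mem_enum => /andP[? _] ->.
apply: uniq_ends (uniq_nbwalks _ _ _) _ => p q; rewrite !mem_nbwalks.
case/andP=> sp wp /andP[sq wq] lpq; apply: (nbwalk_inj wp wq lpq).
by rewrite (leq_ltn_trans _ dg) // -addnn leq_add.
Qed.

(** The walks on either side do not start along the edge. A common end would identify [v :: p] with
    a walk [q] from [u] whose first step avoids [v]; together these have length at most
    [d.*2.+1]. *)
Lemma walk_count_edge (P : {set T}) d u v : f u v -> d.*2.+1 < g ->
  walk_count P d u v + walk_count P d v u <= #|P|.
Proof.
move=> fuv dg; rewrite /walk_count -!size_filter.
rewrite -(size_map (last v)) -(size_map (last u) [seq _ <- nbwalks d v u | _]).
rewrite -size_cat cardE.
apply: uniq_leq_size => [|z]; last first.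
  by rewrite mem_cat => /orP[] /mapP[p]; rewrite mem_filter mem_enum => /andP[? _] ->.
have inj x y : {in nbwalks d x y &, injective (last y)}.
  move=> p q; rewrite !mem_nbwalks => /andP[sp wp] /andP[sq wq] lpq.
  by apply: (nbwalk_inj wp wq lpq); rewrite (leq_ltn_trans _ (ltnW dg)) // -addnn leq_add.
rewrite cat_uniq !uniq_ends ?uniq_nbwalks //= andbT; apply/hasPn => z.
case/mapP=> q; rewrite mem_filter mem_nbwalks => /and3P[_ sq wq] ->.
apply/negP => /mapP[p]; rewrite mem_filter mem_nbwalks => /and3P[_ sp wp] lpq.
have wp' : nbwalk u u (v :: p).
  by rewrite /= fuv wp andbT /=; apply: contraTneq fuv => ->; rewrite f_irr.
have lsz : size q + size (v :: p) < g.
  by rewrite (leq_ltn_trans _ dg) //= addnS ltnS -addnn leq_add.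
have qvp := nbwalk_inj (nbwalk_start wq) wp' lpq lsz.
by move: wq; rewrite qvp /= eqxx andbF.
Qed.

End NonBacktrackingWalks.

(** * Degrees and walks inside a vertex set *)

(** The geometric sum of [q ^ i] over [i < d]. *)
Fixpoint geo (q d : nat) : nat := if d is d'.+1 then 1 + q * geo q d' else 0.

(* [wgeo q d] is the sum of [(i + 1) q ^ i] over [i < d]. *)
Fixpoint wgeo (q d : nat) : nat :=
  if d is d'.+1 then geo q d + q * wgeo q d' else 0.

Lemma geo1 d : geo 1 d = d.
Proof. by elim: d => //= d ->; rewrite mul1n. Qed.

Section DartCounts.
Variables (T : finType) (e : rel T).
Hypotheses (e_sym : symmetric e) (e_irr : irreflexive e).
Implicit Types (A B H : {set T}).

Definition deg_in H x := \sum_(y in H) e x y.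

(** Edges are counted with orientation: [darts H H] is twice the number of edges inside [H], while
    [darts H (~: H)] is the number of edges leaving [H]. *)
Definition darts A B := \sum_(x in A) deg_in B x.

Definition induced H : rel T := fun x y => [&& e x y, x \in H & y \in H].

Lemma darts_sym A B : darts A B = darts B A.
Proof.
rewrite /darts /deg_in exchange_big; apply: eq_bigr => x _.
by apply: eq_bigr => y _; rewrite e_sym.
Qed.

Lemma dartsDl A B H : [disjoint A & B] ->
  darts (A :|: B) H = darts A H + darts B H.
Proof.
move=> dAB; rewrite /darts -bigU //=; apply: eq_bigl => x.
by rewrite !inE.
Qed.

Lemma dartsDr A B H : [disjoint A & B] ->
  darts H (A :|: B) = darts H A + darts H B.
Proof. by move=> dAB; rewrite darts_sym dartsDl // !(darts_sym H). Qed.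

Lemma deg_inD1 H x v : v \in H -> deg_in H x = e x v + deg_in (H :\ v) x.
Proof. by move=> vH; rewrite /deg_in (big_setD1 v). Qed.

Lemma darts_delete H v : v \in H ->
  darts H H = darts (H :\ v) (H :\ v) + 2 * deg_in H v.
Proof.
move=> vH; rewrite /darts (big_setD1 v) //=.
rewrite (eq_bigr (fun x => e x v + deg_in (H :\ v) x)); last first.
  by move=> x _; apply: deg_inD1.
rewrite big_split /=; have -> : \sum_(x in H :\ v) e x v = deg_in H v.
  rewrite (deg_inD1 v vH) e_irr add0n; apply: eq_bigr => x _.
  by rewrite e_sym.
by rewrite mul2n -addnn addnA addnC.
Qed.

Lemma deg_in_leq A B x : A \subset B -> deg_in A x <= deg_in B x.
Proof.
move=> sAB; rewrite /deg_in [leqRHS](big_setID A) /= (setIidPr sAB).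
exact: leq_addr.
Qed.

Lemma induced_sym H : symmetric (induced H).
Proof. by move=> x y; rewrite /induced e_sym; case: (e y x) => //=; rewrite andbC. Qed.

Lemma induced_irr H : irreflexive (induced H).
Proof. by move=> x; rewrite /induced e_irr. Qed.

Lemma induced_cycle H c : is_cycle (induced H) c -> is_cycle e c.
Proof.
case/and3P=> sc cc Uc; rewrite /is_cycle sc /ucycleb Uc andbT /=.
by apply: sub_cycle cc => x y /andP[].
Qed.

Lemma induced_cycle_sub H c : is_cycle (induced H) c -> {subset c <= H}.
Proof.
case/and3P=> _ cc _ x xc; have := next_cycle cc xc.
by case/and3P.
Qed.

Lemma induced_next H x y : y \in H ->
  \sum_(z | induced H y z && (z != x)) 1 + induced H y x = deg_in H y.
Proof.
move=> yH; rewrite /induced /deg_in [RHS](bigID (fun z => z != x)) /=; congr (_ + _).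
  rewrite big_mkcond [RHS]big_mkcond /=.
  apply: eq_bigr => z _; rewrite yH /=.
  by case: (e y z); case: (z \in H); case: (z != x).
rewrite yH /=; have [xH|xH] := boolP (x \in H).
  rewrite andbT (big_pred1 x) // => z /=; rewrite negbK andbC.
  by case: eqP => // ->.
rewrite andbF big_pred0 // => z; rewrite negbK andbC.
by case: eqP => // ->; apply/negbTE.
Qed.

Variable H : {set T}.

Local Notation wc := (walk_count (induced H) H).

Lemma walk_count_step d x y m : y \in H ->
  (forall z, z \in H -> e y z -> z != x -> m <= wc d y z) ->
  1 + (deg_in H y - induced H y x) * m <= wc d.+1 x y.
Proof.
move=> yH mle; rewrite walk_countS yH leq_add2l -(induced_next x yH) addnK.
rewrite -[leqLHS]/(muln _ m) big_distrl /=; apply: leq_sum => z.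
by case/andP=> /and3P[eyz _ zH] zx; rewrite mul1n mle.
Qed.

Lemma walk_count_geo q d x y : {in H, forall v, q < deg_in H v} -> y \in H ->
  geo q d.+1 <= wc d x y.
Proof.
move=> qH; elim: d x y => [|d IH] x y yH; first by rewrite walk_count0 yH /= muln0.
apply: leq_trans (walk_count_step (m := geo q d.+1) yH _) => [|z zH _ _]; last exact: IH.
rewrite [geo _ _.+2]/= leq_add2l leq_mul2r; apply/orP; right.
by have := qH y yH; case: (induced H y x); lia.
Qed.

(* In a set of minimum degree 2 without adjacent vertices of degree 2, the first
   component counts the walks from a vertex of any degree, the second one those
   from a vertex of degree at least 3. *)
Fixpoint alt_geo (d : nat) : nat * nat :=
  if d is d'.+1 then (1 + (alt_geo d').2, 1 + 2 * (alt_geo d').1) else (1, 1).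

Lemma alt_geo_leq d : (alt_geo d).1 <= (alt_geo d).2 <= 2 * (alt_geo d).1.
Proof. by elim: d => //= d; lia. Qed.

Lemma walk_count_alt d x y : {in H, forall v, 1 < deg_in H v} ->
  {in H &, forall u v, e u v -> 2 < deg_in H u \/ 2 < deg_in H v} -> y \in H ->
  (alt_geo d).1 <= wc d x y /\ (2 < deg_in H y -> (alt_geo d).2 <= wc d x y).
Proof.
move=> H2 H3; elim: d x y => [|d IH] x y yH; first by rewrite walk_count0 yH.
have b3 : 2 < deg_in H y -> (alt_geo d.+1).2 <= wc d.+1 x y.
  move=> y3; apply: leq_trans (walk_count_step (m := (alt_geo d).1) yH _).
    by rewrite /= leq_add2l leq_mul2r; case: (induced H y x); lia.
  by move=> z zH _ _; case: (IH y z zH).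
split=> //; have [/b3|y2] := ltnP 2 (deg_in H y).
  by apply: leq_trans; case/andP: (alt_geo_leq d.+1).
apply: leq_trans (walk_count_step (m := (alt_geo d).2) yH _).
  rewrite /= leq_add2l leq_pmull // subn_gt0.
  by have := H2 y yH; case: (induced H y x); lia.
move=> z zH eyz _; case: (IH y z zH) => _; apply.
by case: (H3 y z yH zH eyz) => //; rewrite ltnNge y2.
Qed.

Variable g : nat.
Hypothesis girth : forall c, is_cycle e c -> g <= size c.

Let girthH c : is_cycle (induced H) c -> g <= size c.
Proof. by move/induced_cycle/girth. Qed.

Lemma deg_in_gt0 v : 0 < deg_in H v -> exists2 u, u \in H & e v u.
Proof.
rewrite lt0n sum_nat_eq0 negb_forall => /existsP[u].
by rewrite negb_imply eqb0 negbK => /andP[]; exists u.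
Qed.

(** A Moore tree that branches with the actual degree of [v] at the root and at least [q]-fold
    elsewhere. In [card_geo_edge] the root is an edge at [v]. *)
Lemma card_geo_vertex q d v : d.*2 < g ->
  {in H, forall v, q < deg_in H v} -> v \in H ->
  1 + deg_in H v * geo q d <= #|H|.
Proof.
move=> dg qH vH.
have := walk_count_vertex (@induced_sym H) (@induced_irr H) girthH H v dg.
apply: leq_trans; case: d dg => [|d] dg; first by rewrite walk_count0 vH muln0.
apply: leq_trans (walk_count_step (m := geo q d.+1) vH _).
  by rewrite induced_irr subn0.
by move=> z zH _ _; apply: walk_count_geo.
Qed.

Lemma card_geo_edge q d v : d.*2.+1 < g ->
  {in H, forall v, q < deg_in H v} -> v \in H ->
  geo q d.+1 + (1 + (deg_in H v).-1 * geo q d) <= #|H|.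
Proof.
move=> dg qH vH; have [|u uH evu] := @deg_in_gt0 v.
  exact: leq_trans (qH v vH).
have iuv : induced H u v by rewrite /induced e_sym evu uH vH.
have := walk_count_edge (@induced_sym H) (@induced_irr H) girthH H iuv dg.
apply: leq_trans; rewrite addnC leq_add ?walk_count_geo //.
case: d dg => [|d] dg; first by rewrite walk_count0 vH muln0.
apply: leq_trans (walk_count_step (m := geo q d.+1) vH _).
  by rewrite leq_add2l leq_mul2r -subn1 leq_sub2l ?orbT ?leq_b1.
by move=> z zH _ _; apply: walk_count_geo.
Qed.

Lemma card_alt_vertex d v : d.*2.+2 < g ->
  {in H, forall v, 1 < deg_in H v} ->
  {in H &, forall u v, e u v -> 2 < deg_in H u \/ 2 < deg_in H v} ->
  v \in H -> 2 < deg_in H v -> 1 + 3 * (alt_geo d).1 <= #|H|.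
Proof.
move=> dg H2 H3 vH v3; rewrite -doubleS in dg.
have := walk_count_vertex (@induced_sym H) (@induced_irr H) girthH H v dg.
apply: leq_trans; apply: leq_trans (walk_count_step (m := (alt_geo d).1) vH _).
  by rewrite induced_irr subn0 leq_add2l leq_mul2r v3 orbT.
by move=> z zH _ _; case: (walk_count_alt d v H2 H3 zH).
Qed.

Lemma card_alt_edge d v : d.*2.+1 < g ->
  {in H, forall v, 1 < deg_in H v} ->
  {in H &, forall u v, e u v -> 2 < deg_in H u \/ 2 < deg_in H v} ->
  v \in H -> 2 < deg_in H v -> (alt_geo d).1 + (alt_geo d).2 <= #|H|.
Proof.
move=> dg H2 H3 vH v3; have [|u uH evu] := @deg_in_gt0 v; first exact: leq_trans v3.
have iuv : induced H u v by rewrite /induced e_sym evu uH vH.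
have := walk_count_edge (@induced_sym H) (@induced_irr H) girthH H iuv dg.
apply: leq_trans; rewrite addnC leq_add //.
  by case: (walk_count_alt d u H2 H3 vH) => _; apply.
by case: (walk_count_alt d v H2 H3 uH).
Qed.

Lemma induced_has_cycle : H != set0 -> {in H, forall v, 1 < deg_in H v} ->
  exists2 c, is_cycle e c & {subset c <= H}.
Proof.
case/set0Pn=> v vH H2.
(* Minimum degree 2 allows non-backtracking walks of every length; one of length [#|T|] repeats a
   vertex. *)
have ext m x y : y \in H -> exists2 p, nbwalk (induced H) x y p & size p = m.
  elim: m x y => [|m IH] x y yH; first by exists [::].
  case: (pickP (fun z => induced H y z && (z != x))) => [z /andP[iyz zx]|n0]; last first.
    have := induced_next x yH; rewrite big_pred0 //.
    by have := H2 y yH; case: (induced H y x); lia.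
  case/and3P: (iyz) => _ _ zH; have [p wp sp] := IH y z zH.
  by exists (z :: p); rewrite /= ?sp // iyz zx.
have [p wp sp] := ext #|T| v v vH.
have [|c cc _] := nbwalk_cycle (@induced_irr H) wp.
  by apply/negP => /card_uniqP; apply/eqP; rewrite neq_ltn /= sp ltnS max_card.
by exists c; [apply: induced_cycle cc|apply: induced_cycle_sub cc].
Qed.

End DartCounts.

(** * Counting walks that leave a vertex set *)

Section RegularGraphs.
Variables (T : finType) (e : rel T) (k g : nat).
Hypotheses (e_sym : symmetric e) (e_irr : irreflexive e).
Hypotheses (e_reg : regular e k) (girth : forall c, is_cycle e c -> g <= size c).
Implicit Types (A B H : {set T}).

Local Notation q := k.-1.

Lemma sum_nbr_const x m : \sum_(y | e x y) m = k * m.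
Proof. by rewrite sum_nat_const -(e_reg x). Qed.

Lemma sum_next_const x y m : e x y -> \sum_(z | e y z && (z != x)) m = q * m.
Proof.
move=> exy; rewrite sum_nat_const; congr (_ * _).
have := e_reg y; rewrite (cardD1 x) -[x \in e y]/(e y x) e_sym exy add1n => <-.
by apply: eq_card => z; rewrite !inE andbC.
Qed.

Lemma deg_inC H x : deg_in e H x + deg_in e (~: H) x = k.
Proof.
rewrite -[RHS]muln1 -(sum_nbr_const x) /deg_in [RHS]big_mkcond /=.
rewrite [RHS](bigID (mem H)) /=; congr (_ + _).
by apply: eq_big => y *; rewrite ?inE; case: (e x y).
Qed.

Lemma darts_inC H : darts e H H + darts e H (~: H) = k * #|H|.
Proof.
rewrite /darts -big_split /= (eq_bigr (fun=> k)) => [|x _]; last exact: deg_inC.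
by rewrite sum_nat_const mulnC.
Qed.

Lemma walk_countT d x y : e x y -> walk_count e setT d x y = geo q d.+1.
Proof.
elim: d x y => [|d IH] x y exy; first by rewrite walk_count0 inE /= muln0.
rewrite walk_countS inE [geo _ d.+2]/=; congr (_ + _).
rewrite -(sum_next_const (geo q d.+1) exy); apply: eq_bigr => z /andP[eyz _].
exact: IH.
Qed.

Lemma walk_countT_start d v : walk_count e setT d v v = 1 + k * geo q d.
Proof.
case: d => [|d]; first by rewrite walk_count0 inE muln0.
rewrite walk_countS inE -(sum_nbr_const v); congr (_ + _).
apply: eq_big => [z|z /andP[evz _]]; last exact: walk_countT.
by rewrite andb_idr //; apply: contraTneq => ->; rewrite e_irr.
Qed.

(** The index [d] bounds the steps after the first one, so the walks have between 1 and [d.+1]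
    steps. *)
Definition leaving_walks H d :=
  \sum_(x in H) \sum_(y | e x y) walk_count e (~: H) d x y.

Definition inner_leaving_walks H d :=
  \sum_(x in H) \sum_(y in H | e x y) walk_count e (~: H) d x y.

(** Without its first step, an inner walk is a leaving walk from [y] to [z] and onwards. At most [q]
    inner walks yield the same one, as the dropped vertex is a neighbour of [y] other than [z]. *)
Lemma inner_leaving_walks_leq H d :
  inner_leaving_walks H d.+1 <= q * leaving_walks H d.
Proof.
rewrite /inner_leaving_walks.
under eq_bigr => x xH do under eq_bigr => y /andP[yH _] do
  rewrite walk_countS inE yH add0n.
rewrite (exchange_big_dep (mem H)) /=; last by move=> ? ? _ /andP[].
rewrite /leaving_walks big_distrr /=; apply: leq_sum => y yH.
under eq_bigr => x _ do rewrite big_mkcondr.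
rewrite exchange_big /= big_distrr /=; apply: leq_sum => z eyz.
rewrite -(sum_next_const _ (x := z) (y := y)) ?(e_sym z) //.
rewrite big_mkcond [leqRHS]big_mkcond /=; apply: leq_sum => x _.
rewrite (e_sym x) yH eq_sym /=.
by case: (x \in H); case: (e y x); case: (x != z).
Qed.

(* Either the first step of the walk already leaves [H], or the walk goes on from
   its second vertex, each dart having at most [k - 1] predecessors. *)
Lemma leaving_walks_leq H d :
  leaving_walks H d <= darts e H (~: H) * wgeo q d.+1.
Proof.
have exit d' : leaving_walks H d' <=
    darts e H (~: H) * geo q d'.+1 + inner_leaving_walks H d'.
  rewrite /leaving_walks /darts /inner_leaving_walks big_distrl -big_split /=.
  apply: leq_sum => x _; rewrite (bigID (mem H)) /= addnC leq_add //.
    rewrite /deg_in big_distrl /= big_mkcond [leqRHS]big_mkcond /=.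
    apply: leq_sum => y _; rewrite inE; case: (y \in H); rewrite ?andbF ?andbT //=.
    case exy: (e x y); rewrite // mul1n -[leqRHS](walk_countT _ exy).
    rewrite -(walk_countC _ (~: H)).
    exact: leq_addr.
  by under eq_bigl => y do rewrite andbC.
elim: d => [|d IH].
  apply: leq_trans (exit 0) _.
  have -> : inner_leaving_walks H 0 = 0; last by rewrite /= !muln0 !addn0.
  rewrite /inner_leaving_walks big1 // => x _; rewrite big1 // => y /andP[yH _].
  by rewrite walk_count0 inE yH.
apply: leq_trans (exit _) _; rewrite [wgeo _ d.+2]/= mulnDr leq_add2l.
apply: leq_trans (inner_leaving_walks_leq H d) _.
by rewrite mulnCA leq_mul2l IH orbT.
Qed.

(** Exactly [1 + k * geo q d] walks of length at most [d] start at each vertex of [H]. Those ending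
    in [H] have distinct ends; the others are bounded by [leaving_walks_leq]. *)
Lemma cut_bound_odd H d : d.*2 < g ->
  #|H| * (1 + k * geo q d) <= #|H| ^ 2 + darts e H (~: H) * wgeo q d.
Proof.
move=> dg; rewrite -sum_nat_const -mulnn -sum_nat_const.
apply: (@leq_trans (\sum_(v in H) (#|H| + walk_count e (~: H) d v v))).
  apply: leq_sum => v vH; rewrite -(walk_countT_start d v) -(walk_countC _ H).
  by rewrite leq_add2r (walk_count_vertex e_sym e_irr girth).
rewrite big_split leq_add2l; case: d dg => [|d] dg.
  rewrite muln0 big1 // => v vH; by rewrite walk_count0 inE vH.
apply: leq_trans (leaving_walks_leq H d); apply: leq_sum => v vH.
rewrite walk_countS inE vH add0n big_mkcondr /=.
by apply: leq_sum => z _; case: ifP.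
Qed.

(** The same count with trees rooted at the edges inside [H]: each dart has [2 * geo q d.+1] walks,
    at most [#|H|] of which end in [H]. *)
Lemma cut_bound_even H d : d.*2.+1 < g ->
  darts e H H * (2 * geo q d.+1) <=
  darts e H H * #|H| + 2 * (q * (darts e H (~: H) * wgeo q d)).
Proof.
move=> dg; have dartsE m : darts e H H * m = \sum_(x in H) \sum_(y in H | e x y) m.
  rewrite /darts big_distrl /=; apply: eq_bigr => x _.
  rewrite /deg_in big_distrl big_mkcondr /=; apply: eq_bigr => y _.
  by case: (e x y); rewrite ?mul1n.
apply: (@leq_trans (darts e H H * #|H| + 2 * inner_leaving_walks H d)); last first.
  rewrite leq_add2l leq_mul2l /=; case: d dg => [|d] _.
    rewrite /inner_leaving_walks big1 // => x _; rewrite big1 // => y /andP[yH _].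
    by rewrite walk_count0 inE yH.
  apply: leq_trans (inner_leaving_walks_leq H d) _.
  by rewrite leq_mul2l leaving_walks_leq orbT.
(* Reversing all darts shows that the two sides of the edges contribute equally. *)
have swap : inner_leaving_walks H d =
    \sum_(x in H) \sum_(y in H | e x y) walk_count e (~: H) d y x.
  rewrite /inner_leaving_walks (exchange_big_dep (mem H)) /=; last by move=> ? ? _ /andP[].
  apply: eq_bigr => x xH; apply: eq_bigl => y.
  by rewrite xH e_sym.
rewrite [2 * inner_leaving_walks _ _]mul2n -addnn {2}swap !dartsE.
rewrite /inner_leaving_walks -!big_split /=.
apply: leq_sum => x xH; rewrite -!big_split /=; apply: leq_sum => y /andP[yH exy].
rewrite -[1 + _]/(geo q d.+1) mul2n -addnn -{1}(walk_countT d exy).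
rewrite -(@walk_countT d y x) 1?e_sym //.
rewrite -!(walk_countC _ H) addnACA leq_add2r.
exact: (walk_count_edge e_sym e_irr girth).
Qed.

End RegularGraphs.

(** * Minimal sets with few leaving edges *)

Lemma half_girthE g : 0 < g -> g = (half_girth g).*2 + (if odd g then 1 else 2).
Proof. by rewrite /half_girth; case: ifP => og; lia. Qed.

(** * Small vertex sets in a graph of girth at least [g] *)

Section Girth.
Variables (T : finType) (e : rel T) (g : nat).
Hypotheses (e_sym : symmetric e) (e_irr : irreflexive e).
Hypotheses (girth : forall c, is_cycle e c -> g <= size c).
Hypothesis g_ge5 : 4 < g.
Implicit Types (A B H : {set T}).

Local Notation d := (half_girth g).
Local Notation deg := (deg_in e).

Let dE : g = d.*2 + (if odd g then 1 else 2).
Proof. exact/half_girthE/(ltn_trans _ g_ge5). Qed.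

Lemma girth_leq_card H : H != set0 -> {in H, forall v, 1 < deg H v} -> g <= #|H|.
Proof.
move=> H0 H2; have [c cc cH] := induced_has_cycle e_irr H0 H2.
apply: leq_trans (girth cc) _; rewrite cardE.
apply: uniq_leq_size => [|x xc]; last by rewrite mem_enum cH.
by case/and3P: cc.
Qed.

(** The Moore tree with [q = 1], which branches only at the root [v], already has this many
    vertices. *)
Lemma branching_card H v : {in H, forall v, 1 < deg H v} -> v \in H ->
  2 < deg H v -> 3 * d + (if odd g then 1 else 2) <= #|H|.
Proof.
move=> H2 vH v3; move: dE; case: ifP => og gE.
  have := card_geo_vertex e_sym e_irr girth (d := d) (q := 1) _ H2 vH.
  rewrite geo1 => /(_ ltac:(lia)); apply: leq_trans.
  by rewrite addnC leq_add2l leq_mul2r v3 orbT.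
have := card_geo_edge e_sym e_irr girth (d := d) (q := 1) _ H2 vH.
rewrite !geo1 => /(_ ltac:(lia)); apply: leq_trans.
have : 2 * d <= (deg H v).-1 * d by rewrite leq_mul2r; lia.
by lia.
Qed.

Lemma low_degree H : H != set0 -> #|H| < g -> exists2 v, v \in H & deg H v <= 1.
Proof.
move=> H0 Hg; case: (pickP (fun v => (v \in H) && (deg H v <= 1))) => [v /andP[]|no].
  by exists v.
have H2 : {in H, forall v, 1 < deg H v}.
  by move=> v vH; move: (no v); rewrite vH /= ltnNge => ->.
by have := girth_leq_card H0 H2; rewrite leqNgt Hg.
Qed.

(** Fewer than [g] vertices span a forest, so vertices of degree at most 1 can be removed one after
    the other. *)
Lemma darts_forest H : 0 < #|H| < g -> darts e H H + 2 <= 2 * #|H|.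
Proof.
elim: {H}#|H| {-2}H (leqnn #|H|) => [|m IH] H; first by lia.
move=> Hm Hg; have [|v vH v1] := @low_degree H _ (proj2 (andP Hg)).
  by rewrite -card_gt0; case/andP: Hg.
have cH := cardsD1 v H; rewrite vH in cH.
rewrite (darts_delete e_sym e_irr vH); have [H1|H1] := posnP #|H :\ v|.
  have v0 : deg H v = 0.
    rewrite (deg_inD1 _ v vH) e_irr /deg_in big_pred0 // => x.
    by move/eqP: H1; rewrite cards_eq0 => /eqP->; rewrite inE.
  move/eqP: H1; rewrite cards_eq0 => /eqP H1; rewrite H1 cards0 in cH *.
  by rewrite /darts big_set0; lia.
have := IH (H :\ v); lia.
Qed.

(** Removing a vertex of degree at most 1 would leave [g - 1] vertices with too many edges for a
    forest. A vertex of degree 3 would require more than [g] vertices by [branching_card]. *)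
Lemma darts_girth H : #|H| = g -> 2 * g <= darts e H H ->
  {in H, forall v, deg H v = 2}.
Proof.
move=> Hg dH; have H2 : {in H, forall v, 1 < deg H v}.
  move=> v vH; rewrite ltnNge; apply/negP => v1.
  have cH := cardsD1 v H; rewrite vH in cH.
  have := darts_delete e_sym e_irr vH; have := @darts_forest (H :\ v); lia.
move=> v vH; apply/eqP; rewrite eqn_leq H2 // andbT leqNgt; apply/negP => v3.
by have := branching_card H2 vH v3; have := dE; case: ifP => _; lia.
Qed.

Lemma darts_deg2 H : {in H, forall v, deg H v = 2} -> darts e H H = 2 * #|H|.
Proof.
move=> H2; rewrite /darts (eq_bigr (fun=> 2)) => [|v vH]; last exact: H2.
by rewrite sum_nat_const mulnC.
Qed.

Lemma darts_girth_leq H : #|H| = g -> darts e H H <= 2 * g.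
Proof.
move=> Hg; rewrite leqNgt; apply/negP => dH.
have := darts_deg2 (darts_girth Hg (ltnW dH)); lia.
Qed.

(** With two neighbours in [A], adding [x] would give a set of minimum degree 2 with a branching
    vertex but only [g + 1] vertices, which [branching_card] excludes for [d >= 2]. *)
Lemma deg_in_girth A x : #|A| = g -> {in A, forall v, deg_in e A v = 2} ->
  x \notin A -> deg_in e A x <= 1.
Proof.
move=> Ag A2 xA; rewrite leqNgt; apply/negP => x2.
have degU v : deg_in e (x |: A) v = e v x + deg_in e A v.
  by rewrite /deg_in big_setU1.
have U2 : {in x |: A, forall v, 1 < deg_in e (x |: A) v}.
  move=> v; rewrite degU !inE => /predU1P[->|vA]; first by rewrite e_irr.
  by rewrite A2 // addnC.
have [a aA exa] := deg_in_gt0 (ltnW x2).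
have := @branching_card _ a U2.
rewrite degU e_sym exa A2 // !inE aA orbT => /(_ erefl erefl).
rewrite cardsU1 xA Ag; have := half_girthE (ltn_trans (isT : 0 < 4) g_ge5).
by case: ifP => _; lia.
Qed.

End Girth.

(** * Degrees and sizes of the minimal sets *)

Section Cores.
Variables (T : finType) (e : rel T) (k g : nat).
Hypotheses (e_sym : symmetric e) (e_irr : irreflexive e).
Hypotheses (girth : forall c, is_cycle e c -> g <= size c).
Hypotheses (k_ge3 : 2 < k) (g_ge5 : 4 < g).
Implicit Types (A B H : {set T}).

Local Notation d := (half_girth g).
Local Notation deg := (deg_in e).

Let dE : g = d.*2 + (if odd g then 1 else 2).
Proof. exact/half_girthE/(ltn_trans _ g_ge5). Qed.

(* In a [k]-regular graph, this says that at most [(k - 2) * g] edges leave [H]. *)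
Definition small_cut H := k * #|H| <= darts e H H + (k - 2) * g.

Lemma small_cut_darts H : small_cut H -> g <= #|H| ->
  2 * #|H| + (k - 2) * (#|H| - g) <= darts e H H.
Proof.
rewrite /small_cut => + gH; have {1}-> : k = 2 + (k - 2) by lia.
by rewrite mulnDl mulnBr; have := leq_mul (leqnn (k - 2)) gH; lia.
Qed.

(** In a [k]-regular graph, deleting [v] turns [deg H v] inner edges into leaving ones and drops the
    [k - deg H v] leaving edges at [v]. *)
Lemma small_cut_delete H v : v \in H -> 2 * deg H v <= k ->
  small_cut H -> small_cut (H :\ v).
Proof.
move=> vH vk; rewrite /small_cut (darts_delete e_sym e_irr vH) (cardsD1 v H) vH.
by rewrite mulnDr; lia.
Qed.

(** The strict inequality keeps out the cycles of length [g], which satisfy [small_cut] with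
    equality. *)
Definition core H := minset (fun A => small_cut A && (g < #|A|)) H.

Lemma core_exists H : small_cut H -> g < #|H| -> exists2 H0, core H0 & #|H0| <= #|H|.
Proof.
move=> sH gH; have [|H0 cH0 sH0] := @minset_exists _ (fun A => small_cut A && (g < #|A|)) H.
  by rewrite sH gH.
by exists H0 => //; apply: subset_leq_card.
Qed.

Section Core.
Variable H : {set T}.
Hypothesis coreH : core H.

Let smallH : small_cut H. Proof. by case/andP: (minsetp coreH). Qed.
Let gH : g < #|H|. Proof. by case/andP: (minsetp coreH). Qed.

Let minH A : A \proper H -> small_cut A -> #|A| <= g.
Proof.
move=> pA sA; rewrite leqNgt; apply/negP => gA.
have := minsetinf coreH; move=> /(_ A); rewrite sA gA => /(_ erefl (proper_sub pA)) AH.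
by rewrite AH properxx in pA.
Qed.

(** Deleting a vertex of degree at most 1 would leave, by minimality, exactly [g] vertices and so at
    most [2 * g] darts. Then [H] has at most [2 * g + 2] darts, while [small_cut_darts] demands
    [2 * g + 2 + (k - 2)]. *)
Lemma core_deg2 : {in H, forall v, 1 < deg H v}.
Proof.
move=> v vH; rewrite ltnNge; apply/negP => v1.
have cH := cardsD1 v H; rewrite vH in cH.
have := minH (properD1 vH); rewrite small_cut_delete //; last by lia.
move=> /(_ erefl) Hvg; have Hg : #|H :\ v| = g by lia.
have := darts_girth_leq e_sym e_irr girth g_ge5 Hg; have := darts_delete e_sym e_irr vH.
have := small_cut_darts smallH (ltnW gH).
have -> : #|H| - g = 1 by lia.
by lia.
Qed.

Lemma core_branching : exists2 v, v \in H & 2 < deg H v.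
Proof.
case: (pickP (fun v => (v \in H) && (2 < deg H v))) => [v /andP[]|no]; first by exists v.
have /darts_deg2 dH : {in H, forall v, deg H v = 2}.
  move=> v vH; apply/eqP; rewrite eqn_leq core_deg2 // andbT leqNgt.
  by have := no v; rewrite vH => /= ->.
have := small_cut_darts smallH (ltnW gH); rewrite dH.
have : 0 < (k - 2) * (#|H| - g) by rewrite muln_gt0; lia.
by lia.
Qed.

Lemma core_card : 3 * d + (if odd g then 1 else 2) <= #|H|.
Proof.
have [v vH v3] := core_branching.
exact: (branching_card e_sym e_irr girth g_ge5 core_deg2 vH v3).
Qed.

(** By [core_card] the core has more than [g + 1] vertices, so deleting a vertex of degree at most
    [k / 2] contradicts minimality. *)
Lemma core_deg_half j : 2 * j <= k -> {in H, forall v, j < deg H v}.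
Proof.
move=> jk v vH; rewrite ltnNge; apply/negP => vj.
have cH := cardsD1 v H; rewrite vH in cH.
have := minH (properD1 vH); rewrite small_cut_delete //; last by lia.
move=> /(_ erefl); have := core_card; have := dE.
by case: ifP => _; lia.
Qed.

(** Deleting two adjacent vertices of degree 2 removes 6 darts, which equals [k * 2], so [small_cut]
    persists. For [d >= 3] more than [g] vertices remain, against minimality. *)
Lemma core_deg2_indep : k = 3 -> 3 <= d ->
  {in H &, forall u v, e u v -> 2 < deg H u \/ 2 < deg H v}.
Proof.
move=> k3 d3 u v uH vH euv.
have [?|u2] := ltnP 2 (deg H u); first by left.
have [?|v2] := ltnP 2 (deg H v); first by right.
have neq : u != v by apply: contraTneq euv => ->; rewrite e_irr.
have vHu : v \in H :\ u by rewrite !inE eq_sym neq.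
have cH := cardsD1 u H; rewrite uH in cH.
have cHu := cardsD1 v (H :\ u); rewrite vHu in cHu.
have := minH (proper_sub_trans (properD1 vHu) (subD1set _ _)).
have du := darts_delete e_sym e_irr uH.
have dv := darts_delete e_sym e_irr vHu.
have := deg_inD1 e v uH; rewrite (e_sym v) euv => duv.
rewrite /small_cut k3; move: smallH; rewrite /small_cut k3 => sH.
have := core_card; have := dE.
by case: ifP => _ gE cc /(_ _)-H1; have := H1 ltac:(lia); lia.
Qed.

Lemma core_card_half_odd j : odd g -> 2 * j <= k -> 1 + j.+1 * geo j d <= #|H|.
Proof.
move=> og jk; have [v vH _] := core_branching.
move: dE; rewrite og => gE.
have := card_geo_vertex e_sym e_irr girth (d := d) _ (core_deg_half jk) vH.
move=> /(_ ltac:(lia)); apply: leq_trans; rewrite leq_add2l leq_mul2r.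
by rewrite core_deg_half ?orbT.
Qed.

Lemma core_card_half_even j : ~~ odd g -> 2 * j <= k -> 2 * geo j d.+1 <= #|H|.
Proof.
move=> /negbTE og jk; have [v vH _] := core_branching.
move: dE; rewrite og => gE.
have := card_geo_edge e_sym e_irr girth (d := d) _ (core_deg_half jk) vH.
move=> /(_ ltac:(lia)); apply: leq_trans; rewrite mul2n -addnn leq_add2l /=.
rewrite leq_add2l leq_mul2r; have := core_deg_half jk vH; lia.
Qed.

Lemma core_card_cubic_odd : k = 3 -> odd g -> 3 <= d ->
  1 + 3 * (alt_geo d.-1).1 <= #|H|.
Proof.
move=> k3 og d3; have [v vH v3] := core_branching.
move: dE; rewrite og => gE.
apply: (card_alt_vertex e_sym e_irr girth _ core_deg2 (core_deg2_indep k3 d3) vH v3).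
by lia.
Qed.

Lemma core_card_cubic_even : k = 3 -> ~~ odd g -> 3 <= d ->
  (alt_geo d).1 + (alt_geo d).2 <= #|H|.
Proof.
move=> k3 /negbTE og d3; have [v vH v3] := core_branching.
move: dE; rewrite og => gE.
apply: (card_alt_edge e_sym e_irr girth _ core_deg2 (core_deg2_indep k3 d3) vH v3).
by lia.
Qed.

End Core.
End Cores.

(** * Arithmetic of the Moore bounds *)

Lemma geoE q d : 0 < q -> (q - 1) * geo q d + 1 = q ^ d.
Proof.
move=> q0; elim: d => [|d IH] /=; first by rewrite muln0.
by rewrite expnS -IH mulnDr muln1 mulnDr mulnCA; lia.
Qed.

Lemma wgeo2E d : wgeo 2 d + 2 ^ d = d * 2 ^ d + 1.
Proof.
elim: d => //= d IH; have := geoE d (isT : 0 < 2).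
rewrite expnS; move: IH; move: (2 ^ d) (geo 2 d) (wgeo 2 d) => X A D.
by rewrite subn1 mul1n !mulnDr mulSn; nia.
Qed.

Lemma wgeo_leq q d : wgeo q d <= d * geo q d.
Proof.
elim: d => //= d IH; have : q * wgeo q d <= q * (d * geo q d) by rewrite leq_mul2l IH orbT.
by rewrite mulSn mulnDr muln1 mulnCA; lia.
Qed.

Lemma leq_geo q1 q2 d : q1 <= q2 -> geo q1 d <= geo q2 d.
Proof. by move=> q12; elim: d => //= d IH; rewrite leq_add2l leq_mul. Qed.

Lemma sqr_leq_exp2 d : 3 < d -> d ^ 2 <= 2 ^ d.
Proof.
elim: d => // d IH; rewrite ltnS leq_eqVlt => /predU1P[<- //|d4].
by have := IH d4; rewrite [2 ^ d.+1]expnS -!mulnn; move: (2 ^ d) => X; nia.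
Qed.

Lemma alt_geo_odd m : 2 < m -> m.+1 ^ 2 <= 1 + 3 * (alt_geo m).1.
Proof.
(* [(alt_geo m.+2).1] depends on [(alt_geo m).1], so the induction carries two consecutive cases. *)
suff H : forall m, (m.+4 ^ 2 <= 1 + 3 * (alt_geo m.+3).1) /\
  (m.+4.+1 ^ 2 <= 1 + 3 * (alt_geo m.+4).1).
  by case: m => [|[|[|m]]] // _; case: (H m).
elim=> [|{}m [IH1 IH2]]; split=> //; move: IH1; rewrite -!mulnn /=; nia.
Qed.

Lemma alt_geo_even m : 3 < m -> m ^ 2 + m <= (alt_geo m).1 + (alt_geo m).2.
Proof.
suff H : forall m, (m.+4 ^ 2 + m.+4 <= (alt_geo m.+4).1 + (alt_geo m.+4).2) /\
  (m.+4.+1 ^ 2 + m.+4.+1 <= (alt_geo m.+4.+1).1 + (alt_geo m.+4.+1).2).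
  by case: m => [|[|[|[|m]]]] // _; case: (H m).
elim=> [|{}m [IH1 IH2]]; split=> //; move: IH1; rewrite -!mulnn /=; nia.
Qed.

(** A convex parabola that is negative at [y] and nonnegative at some [n >= y] has its vertex
    [N / (2 * a)] to the left of [n]. *)
Lemma quadratic_vertex a N c y n : y <= n -> a * y ^ 2 + c < N * y ->
  N * n <= a * n ^ 2 + c -> N <= 2 * a * n.
Proof.
move=> yn Py Pn; rewrite leqNgt; apply/negP => nN.
have [t nE] : exists t, n = y + t by exists (n - y); lia.
have : N * t < a * (t * (2 * y + t)) by move: Pn Py; rewrite nE -!mulnn; nia.
have : a * (2 * y + t) <= N by apply: leq_trans (ltnW nN); rewrite nE; nia.
by move=> /(leq_mul (leqnn t)); lia.
Qed.

(** The test point [d ^ 2] is at most the size of a cubic core by [alt_geo_odd]; for even girth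
    [alt_geo_even] gives [d ^ 2 + d]. *)
Lemma cubic_gap_odd d : 3 < d ->
  1 * (d ^ 2) ^ 2 + (3 - 2) * d.*2.+1 * wgeo 2 d < (1 + 3 * geo 2 d) * d ^ 2.
Proof.
move=> d4; have := geoE d (isT : 0 < 2); have := wgeo2E d; have := sqr_leq_exp2 d4.
rewrite -!mulnn; move: (2 ^ d) (geo 2 d) (wgeo 2 d) => X A D.
by rewrite -muln2; nia.
Qed.

Lemma cubic_gap_even d (M := 2 * geo 2 d.+1) (s := (3 - 2) * d.*2.+2)
  (y := d ^ 2 + d) : 3 < d ->
  3 * y ^ 2 + (s * M + 2 * s * (2 * wgeo 2 d)) < (3 * M + s) * y.
Proof.
move=> d4; rewrite {}/M {}/s {}/y /=.
have := geoE d (isT : 0 < 2); have := wgeo2E d; have := sqr_leq_exp2 d4.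
rewrite -!mulnn; move: (2 ^ d) (geo 2 d) (wgeo 2 d) => X A D.
by rewrite -muln2; nia.
Qed.

(** With [G = geo k.-1 d], the weighted sum is at most [d * G], so its term is at most
    [(k - 2) * A * G]. Adding [A ^ 2 <= 2 * G * A] gives at most [k * G * A]. *)
Lemma gap_odd k d A : 2 < k -> 0 < d -> (d.*2.+1) * d <= A -> A <= 2 * geo k.-1 d ->
  1 * A ^ 2 + (k - 2) * d.*2.+1 * wgeo k.-1 d < (1 + k * geo k.-1 d) * A.
Proof.
move=> k2 d0 dA AG; have := wgeo_leq k.-1 d.
move: (geo k.-1 d) (wgeo k.-1 d) AG => G D AG DG.
have A0 : 0 < A by apply: leq_trans dA; rewrite muln_gt0 d0.
have sD : (k - 2) * d.*2.+1 * D <= (k - 2) * (A * G).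
  rewrite -mulnA leq_mul2l; apply/orP; right.
  apply: leq_trans (leq_mul (leqnn _) DG) _; rewrite mulnA.
  exact: leq_mul.
have : A * A <= A * (2 * G) by rewrite leq_mul2l AG orbT.
have -> : k = k - 2 + 2 by lia.
by rewrite addnK -mulnn in sD *; nia.
Qed.

(** The point [y] is the bound of [core_card_half_odd] for [j = 2]. For [k = 4] and [d = 2] it is 10
    and exceeds [2 * geo 3 2 = 8], so [gap_odd] does not apply. *)
Lemma noncubic_gap_odd k d (y := 1 + 3 * geo 2 d) :
  3 < k -> 1 < d -> 4 < k \/ 2 < d ->
  1 * y ^ 2 + (k - 2) * d.*2.+1 * wgeo k.-1 d < (1 + k * geo k.-1 d) * y.
Proof.
move=> k4 d2 kd; apply: gap_odd; try by lia.
  rewrite /y; elim: d d2 {y kd} => // d IH; rewrite ltnS leq_eqVlt.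
  by case/predU1P=> [<- //|d_gt]; move: (IH d_gt); rewrite /= -?muln2; nia.
have step q m : 1 < q -> 1 + 3 * geo 2 m <= 2 * geo q m ->
    1 + 3 * geo 2 m.+1 <= 2 * geo q m.+1 by rewrite /=; nia.
have [k5|k5] := ltnP 4 k.
  apply: (@leq_trans (2 * geo 4 d)); last by rewrite leq_mul2l leq_geo //; lia.
  rewrite /y; elim: d d2 {y kd} => // d IH; rewrite ltnS leq_eqVlt.
  by case/predU1P=> [<- //|/IH]; apply: step.
have -> : k = 4 by lia.
have {kd} : 2 < d by lia.
rewrite /y; elim: d d2 {y} => // d IH _; rewrite ltnS leq_eqVlt.
by case/predU1P=> [<- //|d3]; apply: step; rewrite // IH //; lia.
Qed.

(* Since [2 * M - y >= (2 * c - b) / c * M], the last hypothesis is what remains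
   after bounding the weighted sum by [d * M]. *)
Lemma gap_even b c k s y d M Q : Q <= d * M -> 0 < M -> c * y <= b * M ->
  b < 2 * c -> 2 * c * s * d + (2 * c - b) * s < (2 * c - b) * k * y ->
  k * y ^ 2 + (s * (2 * M) + 2 * s * Q) < (k * (2 * M) + s) * y.
Proof.
move=> QM M0 yM bc Hy.
(* In terms of [u = k * y - s] and [t = 2 * M - y], the claim is [2 * s * Q < u * t]. *)
have [u uE] : exists u, k * y = s + u.
  exists (k * y - s); rewrite subnKC // leqNgt; apply/negP => kys.
  by have := leq_mul (leqnn (2 * c - b)) (ltnW kys); lia.
have [m mE] : exists m, 2 * c = b + m by exists (2 * c - b); lia.
have c0 : 0 < c by lia.
rewrite mE addKn in Hy; have {Hy} Hy : 2 * c * s * d < m * u.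
  have mky : m * k * y = m * s + m * u by rewrite -mulnA uE mulnDr.
  by rewrite mE; move: Hy; rewrite mky; lia.
have [t tE] : exists t, 2 * M = y + t.
  by exists (2 * M - y); rewrite subnKC //; move: yM bc; nia.
have tM : m * M <= c * t by move: yM mE tE; nia.
have sQ : 2 * c * s * Q < c * (u * t).
  apply: (@leq_ltn_trans (2 * c * s * d * M)).
    by rewrite -[leqRHS]mulnA leq_mul2l QM orbT.
  apply: (@leq_trans (m * u * M)); first by rewrite ltn_pmul2r.
  by rewrite [leqRHS]mulnCA -[leqLHS]mulnA [leqLHS]mulnCA leq_mul2l tM orbT.
have {}sQ : 2 * s * Q < u * t.
  by rewrite -(ltn_pmul2l c0); move: sQ; nia.
by rewrite tE -mulnn; move: sQ uE; nia.
Qed.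

Lemma weighted_leq q d : q * wgeo q d <= d * geo q d.+1.
Proof. by have := wgeo_leq q d; rewrite /=; nia. Qed.

Lemma noncubic_gap_even k d (M := 2 * geo k.-1 d.+1) (s := (k - 2) * d.*2.+2)
  (y := 2 * geo 2 d.+1) : 3 < k <= 5 -> 2 < d ->
  k * y ^ 2 + (s * M + 2 * s * (k.-1 * wgeo k.-1 d)) < (k * M + s) * y.
Proof.
(* The ratio 3/4 is attained at [k = 4], [d = 3], where [y = 30] and [geo 3 4 = 40]. *)
move=> k45 d3; apply: (@gap_even 3 4 _ _ _ d); rewrite ?weighted_leq //.
  apply: (@leq_trans (3 * geo 3 d.+1)); last by rewrite leq_mul2l leq_geo //; lia.
  rewrite /y; elim: d d3 {M s y} => // d IH; rewrite ltnS leq_eqVlt.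
  by case/predU1P=> [<- //|d_gt]; move: (IH d_gt); rewrite /= -?muln2; nia.
(* This is the last hypothesis of [gap_even] for [k = 5]; it implies the one for [k = 4]. *)
have yd : 3 * (d.*2.+2 * (8 * d + 5)) < 25 * y.
  rewrite /y; elim: d d3 {M s y} => // d IH; rewrite ltnS leq_eqVlt.
  by case/predU1P=> [<- //|d_gt]; move: (IH d_gt); rewrite /= -?muln2; nia.
rewrite /s; have [->|->] : k = 4 \/ k = 5 by lia.
  by move: yd; nia.
by move: yd; nia.
Qed.

Lemma large_gap_even k d (M := 2 * geo k.-1 d.+1) (s := (k - 2) * d.*2.+2)
  (y := 2 * geo 3 d.+1) : 5 < k -> 1 < d ->
  k * y ^ 2 + (s * M + 2 * s * (k.-1 * wgeo k.-1 d)) < (k * M + s) * y.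
Proof.
move=> k6; rewrite leq_eqVlt => /predU1P[d2|d3].
  (* For [d = 2] the estimate [yd] used below fails, as [6 * 5 > 26]; the inequality is expanded in
     [m = k - 6] instead. *)
  rewrite /y /s /M -d2.
  have [m kE] : exists m, k = m + 6 by exists (k - 6); lia.
  have -> : k - 2 = m + 4 by lia.
  have -> : k.-1 = m + 5 by lia.
  by rewrite kE /= -mulnn; nia.
apply: (@gap_even 1 1 _ _ _ d); rewrite ?weighted_leq //.
  rewrite !mul1n; apply: (@leq_trans (geo 5 d.+1)); last by rewrite leq_geo //; lia.
  rewrite /y; elim: d d3 {M s y} => // d IH; rewrite ltnS leq_eqVlt.
  by case/predU1P=> [<- //|d_gt]; move: (IH d_gt); rewrite /= -?muln2; nia.
have yd : d.*2.+2 * d.*2.+1 < y.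
  rewrite /y; elim: d d3 {M s y} => // d IH; rewrite ltnS leq_eqVlt.
  by case/predU1P=> [<- //|d_gt]; move: (IH d_gt); rewrite /= -?muln2; nia.
have [m kE] : exists m, k = m + 2 by exists (k - 2); lia.
by rewrite /s kE addnK; move: yd; nia.
Qed.

(** * The largest root of the polynomial *)

Section LargestRoot.
Local Open Scope ring_scope.
Variables (R : rcfType) (k g s : nat).
Hypothesis k_ge3 : (2 < k)%N.

Local Notation d := (half_girth g).
Local Notation q := k.-1.
Local Notation K := (k%:R : R).

Let qE : q%:R = K - 1.
Proof. by rewrite -[k in RHS]prednK ?(ltnW (ltnW k_ge3)) // -natr1 addrK. Qed.
Let K2 : K - 2 != 0. Proof. by rewrite subr_eq0 eqr_nat neq_ltn k_ge3 orbT. Qed.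

Let geo_natr m : (geo q m)%:R = ((K - 1) ^+ m - 1) / (K - 2).
Proof.
elim: m => [|m IH] /=; first by rewrite expr0 subrr mul0r.
by rewrite natrD natrM IH qE exprS; field.
Qed.

(** This identifies the constant term of [Ppoly]: it is [s * wgeo q d] for odd [g], and for even [g]
    the fraction in it is [q * wgeo q d]. *)
Let wgeo_natr m :
  (wgeo q m)%:R = ((m%:R * K - 2 * m%:R - 1) * (K - 1) ^+ m + 1) / (K - 2) ^+ 2.
Proof.
elim: m => [|m IH]; first by rewrite expr0 /=; field.
rewrite [wgeo _ _]/= -[(1 + _)%N]/(geo q m.+1) natrD natrM IH geo_natr qE exprS -natr1.
by field.
Qed.

Lemma moore_natr : moore R k g =
  (if odd g then 1 + k * geo q d else 2 * geo q d.+1)%N%:R.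
Proof.
rewrite /moore; case: ifP => _; last by rewrite natrM geo_natr; field.
by rewrite natrD natrM geo_natr; field.
Qed.

(** [b2] is either a root, hence not beyond [x], or the default [vbound]. The zero polynomial falls
    under the default too, its [rootsR] being empty. *)
Lemma b2_leq (x : R) : vbound R k g s <= x ->
  (forall y, x < y -> (Ppoly R k g s).[y] != 0) -> b2 R k g s <= x.
Proof.
move=> vx nr; rewrite /b2.
have rP : {subset rootsR (Ppoly R k g s) <= root (Ppoly R k g s)}.
  have [->|p0 r] := eqVneq (Ppoly R k g s) 0; first by rewrite rootsR0.
  by rewrite -(roots_on_rootsR p0) => /andP[].
case: (rootsR _) rP => [|r rs] rP //=.
rewrite leNgt; apply/negP => /nr/eqP; apply.
by apply/rootP/rP/mem_last.
Qed.

(** Here [n] is not left of the vertex and [P] is nonnegative at [n], so [P] is positive beyond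
    [n]. *)
Lemma b2_leq_odd (n : nat) : odd g -> (1 + k * geo q d <= 2 * n)%N ->
  ((1 + k * geo q d) * n <= n ^ 2 + s * wgeo q d)%N -> b2 R k g s <= n%:R.
Proof.
move=> og vn Pn; have mE := moore_natr; rewrite og in mE.
have vn' : moore R k g <= 2 * n%:R by rewrite mE -natrM ler_nat.
apply: b2_leq => [|y ny]; first by rewrite /vbound og; lra.
have cE : (s%:R * (d%:R * K - 2 * d%:R - 1) * (K - 1) ^+ d + s%:R) / (K - 2) ^+ 2 =
  s%:R * (wgeo q d)%:R by rewrite wgeo_natr; field.
rewrite /Ppoly og cE !hornerE mE.
move: Pn vn'; rewrite mE -(ler_nat R) natrM [in leRHS]natrD natrM natrX.
move: (1 + _)%N (wgeo _ _)%:R => M' D Pn; move: M'%:R Pn => M Pn vn'.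
by apply: lt0r_neq0; nra.
Qed.

Lemma b2_leq_even (n : nat) : ~~ odd g ->
  (k * (2 * geo q d.+1) + s <= 2 * k * n)%N ->
  ((k * (2 * geo q d.+1) + s) * n <=
   k * n ^ 2 + (s * (2 * geo q d.+1) + 2 * s * (q * wgeo q d)))%N ->
  b2 R k g s <= n%:R.
Proof.
move=> /negbTE og vn Pn; have mE := moore_natr; rewrite og in mE.
have vn' : K * moore R k g + s%:R <= 2 * K * n%:R.
  by rewrite mE -!natrM -natrD ler_nat.
have K0 : 0 < K by rewrite ltr0n; apply: leq_trans k_ge3.
apply: b2_leq => [|y ny].
  have -> : vbound R k g s = (K * moore R k g + s%:R) / (2 * K).
    by rewrite /vbound og; field; rewrite gt_eqF.
  by rewrite ler_pdivrMr ?mulr_gt0 // [leRHS]mulrC.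
have cE : 2 * s%:R * (((d%:R * K - 2 * d%:R - 1) * (K - 1) ^+ d.+1 + K - 1) /
    (K - 2) ^+ 2) = 2 * s%:R * ((K - 1) * (wgeo q d)%:R).
  by rewrite wgeo_natr exprS; field.
have -> : (Ppoly R k g s).[y] = K * y ^+ 2 - (K * moore R k g + s%:R) * y +
    (s%:R * moore R k g + 2 * s%:R * (q%:R * (wgeo q d)%:R)).
  by rewrite /Ppoly og cE -qE !hornerE /=; ring.
have Pn' : (K * moore R k g + s%:R) * n%:R <= K * n%:R ^+ 2 +
    (s%:R * moore R k g + 2 * s%:R * (q%:R * (wgeo q d)%:R)).
  by rewrite mE -!(natrM, natrX, natrD) ler_nat.
have yn : 0 < K * (y - n%:R) by rewrite mulr_gt0 // subr_gt0.
apply: lt0r_neq0.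
have : 0 < (y - n%:R) * (K * (y + n%:R) - (K * moore R k g + s%:R)).
  by rewrite mulr_gt0 ?subr_gt0 //; lra.
by move: Pn'; rewrite !expr2; lra.
Qed.

End LargestRoot.

(** * Sets with few leaving edges *)

Section SmallCuts.
Variables (R : rcfType) (T : finType) (e : rel T) (k g : nat).
Hypotheses (e_sym : symmetric e) (e_irr : irreflexive e).
Hypotheses (e_reg : regular e k) (girth : forall c, is_cycle e c -> g <= size c).
Hypotheses (k_ge3 : 2 < k) (g_ge5 : 4 < g).
Implicit Types (A B H : {set T}).

Local Notation d := (half_girth g).
Local Notation s := ((k - 2) * g).

Lemma small_cutE H : small_cut e k g H = (darts e H (~: H) <= s).
Proof. by rewrite /small_cut -(darts_inC e_reg H) leq_add2l. Qed.

Lemma large_small_cut H : small_cut e k g H -> g < #|H| ->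
  (b2 R k g s <= #|H|%:R)%R.
Proof.
move=> sH gH; have rs : darts e H (~: H) <= s by rewrite -small_cutE.
have [H0 cH0 H0H] := core_exists sH gH.
have gE := half_girthE (ltn_trans (isT : 0 < 4) g_ge5); move: rs.
have d2 : 1 < d by move: gE; case: ifP => _; lia.
have c0 := core_card e_sym e_irr girth k_ge3 g_ge5 cH0.
have [og|og] := boolP (odd g) => rs; rewrite ?og ?(negbTE og) in gE c0.
  have Pn : (1 + k * geo k.-1 d) * #|H| <= 1 * #|H| ^ 2 + s * wgeo k.-1 d.
    rewrite mulnC mul1n; apply: leq_trans (cut_bound_odd e_sym e_irr e_reg girth _ _) _.
      by lia.
    by rewrite leq_add2l leq_mul2r rs orbT.
  apply: (b2_leq_odd R k_ge3 og); last by move: Pn; rewrite mul1n.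
  rewrite -[2]muln1; have [k3|k4] : k = 3 \/ 3 < k by lia.
    (* In the smallest cases the bound on the core reaches the vertex of [P] directly; in the others
       it reaches a point where [P] is negative. *)
    have [d2'|d3] : d = 2 \/ 2 < d by lia.
      by rewrite d2' k3 /= in c0 *; lia.
    have := core_card_cubic_odd e_sym e_irr girth k_ge3 g_ge5 cH0 k3 og d3.
    have [d3' c1|d4 c1] : d = 3 \/ 3 < d by lia.
      by rewrite d3' k3 /= in c1 *; lia.
    apply: (quadratic_vertex (y := d ^ 2) _ _ Pn).
      by have := @alt_geo_odd d.-1; rewrite prednK; lia.
    by have := cubic_gap_odd d4; rewrite -[d.*2.+1]addn1 -gE k3.
  have := core_card_half_odd (j := 2) e_sym e_irr girth k_ge3 g_ge5 cH0 og _.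
  move=> /(_ ltac:(lia)) c1.
  have [[k4' d2']|kd] : (k = 4 /\ d = 2) \/ (4 < k \/ 2 < d) by lia.
    by rewrite k4' d2' /= in c1 *; lia.
  apply: (quadratic_vertex (y := 1 + 3 * geo 2 d) _ _ Pn); first exact: leq_trans H0H.
  by have := noncubic_gap_odd k4 d2 kd; rewrite -[d.*2.+1]addn1 -gE.
have Pn : (k * (2 * geo k.-1 d.+1) + s) * #|H| <= k * #|H| ^ 2 +
    (s * (2 * geo k.-1 d.+1) + 2 * s * (k.-1 * wgeo k.-1 d)).
  have := cut_bound_even e_sym e_irr e_reg girth H (d := d) ltac:(lia).
  have := darts_inC e_reg H; have ks : s <= k * #|H|.
    by apply: leq_mul; [apply: leq_subr|apply: ltnW].
  move: (darts e H (~: H)) (darts e H H) rs => r E rs.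
  move: (k.-1) (2 * geo _ _) (wgeo _ _) #|H| s rs ks => q M D n s rs ks En.
  (* Over the integers the claim is [(k * n - s) * (M - n) <= 2 * s * q * D]. It is clear for
     [M < n]; otherwise [k * n - s] is at most [E = k * n - r]. *)
  rewrite -mulnn; have [nM|Mn] := leqP n M; last first.
    by move=> _; have := leq_mul ks (ltnW Mn); have := leq_mul ks (leqnn (n - M)); nia.
  have [t ->] : exists t, M = n + t by exists (M - n); lia.
  rewrite mulnDr leq_add2l => Et.
  have : r * (q * D) <= s * (q * D) by rewrite leq_mul2r rs orbT.
  by nia.
have finish y : y <= #|H| ->
    k * y ^ 2 + (s * (2 * geo k.-1 d.+1) + 2 * s * (k.-1 * wgeo k.-1 d)) <
      (k * (2 * geo k.-1 d.+1) + s) * y -> (b2 R k g s <= #|H|%:R)%R.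
  move=> yn Py; apply: (b2_leq_even R k_ge3 og _ Pn).
  exact: quadratic_vertex yn Py Pn.
have gE' : g = d.*2.+2 by lia.
have [k3|k4] : k = 3 \/ 3 < k by lia.
  have [d2'|d3] : d = 2 \/ 2 < d by lia.
    (* For [k = 3] and [g = 6] the bound 8 on the core is exactly [vbound]. *)
    apply: (b2_leq_even R k_ge3 og _ Pn).
    by rewrite gE' d2' k3 /= in c0 *; lia.
  have := core_card_cubic_even e_sym e_irr girth k_ge3 g_ge5 cH0 k3 og d3.
  have [d3' c1|d4 c1] : d = 3 \/ 3 < d by lia.
    (* 15 is [(alt_geo 3).1 + (alt_geo 3).2]. *)
    apply: (finish 15); first by rewrite d3' /= in c1; lia.
    by rewrite gE' d3' k3.
  apply: (finish (d ^ 2 + d)); first by have := alt_geo_even d4; lia.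
  by have := cubic_gap_even d4; rewrite -gE' k3.
have [k5|k6] := leqP k 5; last first.
  have := core_card_half_even (j := 3) e_sym e_irr girth k_ge3 g_ge5 cH0 og _.
  move=> /(_ ltac:(lia)) c1; apply: finish (leq_trans c1 H0H) _.
  by have := large_gap_even k6 d2; rewrite -gE'.
have := core_card_half_even (j := 2) e_sym e_irr girth k_ge3 g_ge5 cH0 og _.
move=> /(_ ltac:(lia)) c1; apply: finish (leq_trans c1 H0H) _.
have [d2'|d3] : d = 2 \/ 2 < d by lia.
  by rewrite gE' d2'; have [->|->] : k = 4 \/ k = 5 by lia.
by have := @noncubic_gap_even k d _ d3; rewrite -gE'; apply; rewrite k4.
Qed.

(** [small_cut] forces at least [2 * g] darts inside [H], and [darts_girth_leq] allows no more. *)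
Lemma girth_cut H : small_cut e k g H -> #|H| = g ->
  darts e H (~: H) = s /\ {in H, forall v, deg_in e H v = 2}.
Proof.
rewrite /small_cut => sH Hg; have dH : 2 * g <= darts e H H.
  move: sH; rewrite Hg => sH; have : k * g = 2 * g + s; last by lia.
  by rewrite -mulnDl subnKC // ltnW.
split; last exact: (darts_girth e_sym e_irr girth g_ge5 Hg dH).
have := darts_girth_leq e_sym e_irr girth g_ge5 Hg; have := darts_inC e_reg H.
have : k * g = 2 * g + s by rewrite -mulnDl subnKC // ltnW.
by rewrite Hg; lia.
Qed.

Hypothesis order : (#|T|%:R < 2 * b2 R k g s)%R.

Lemma disjoint_small_cuts A B : [disjoint A & B] ->
  small_cut e k g A -> small_cut e k g B -> g <= #|A| -> g <= #|B| ->
  #|A| = g \/ #|B| = g.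
Proof.
move=> dAB sA sB; rewrite leq_eqVlt => /predU1P[->|gA]; first by left.
rewrite leq_eqVlt => /predU1P[->|gB]; first by right.
have bAB := lerD (large_small_cut sA gA) (large_small_cut sB gB).
suff ABT : (#|A|%:R + #|B|%:R <= #|T|%:R :> R)%R.
  by have := le_lt_trans (le_trans bAB ABT) order; rewrite mulr_natl mulr2n ltxx.
rewrite -natrD ler_nat -cardsUI.
by move: dAB; rewrite -setI_eq0 => /eqP->; rewrite cards0 addn0 max_card.
Qed.

(** Otherwise [H] and its complement are both small cuts, so one of them has [g] vertices and, by
    [girth_cut], a positive number of leaving edges. *)
Lemma small_cut_gt0 H : g <= #|H| -> g <= #|~: H| -> darts e H (~: H) != 0.
Proof.
move=> gH gC; apply/eqP => d0; have sgt0 : 0 < s by rewrite muln_gt0; lia.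
have dC : darts e (~: H) (~: ~: H) = 0 by rewrite setCK darts_sym.
have := @disjoint_small_cuts H (~: H); rewrite !small_cutE d0 dC.
have -> : [disjoint H & ~: H] by rewrite -setI_eq0 setICr.
case=> // /girth_cut; rewrite small_cutE ?d0 ?dC; case=> //; lia.
Qed.

(* The situation left when deleting the edges around a girth cycle [A] leaves two
   further components [X] and [Y]. *)
Lemma girth_third_part A (X Y : {set T}) : [disjoint A & X] -> [disjoint A & Y] ->
  [disjoint X & Y] -> #|A| = g -> g <= #|X| -> g <= #|Y| ->
  darts e X (~: X) + darts e Y (~: Y) <= s -> False.
Proof.
move=> dAX dAY dXY Ag gX gY dle.
have nz (Z : {set T}) : [disjoint A & Z] -> g <= #|Z| -> darts e Z (~: Z) != 0.
  move=> dAZ gZ; apply: small_cut_gt0 => //; rewrite -Ag subset_leq_card //.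
  by rewrite -disjoints_subset.
have [sX sY] : small_cut e k g X /\ small_cut e k g Y.
  by rewrite !small_cutE; lia.
(* Both boundaries are nonempty, so each has fewer than [s] edges; yet one of [X] and [Y] has [g]
   vertices and hence exactly [s] leaving edges. *)
have := nz X dAX gX; have := nz Y dAY gY.
by case: (disjoint_small_cuts dXY sX sY gX gY) => /girth_cut[] //; lia.
Qed.

End SmallCuts.

(** * Components after deleting an edge cut *)

Section Components.
Variables (T : finType) (e : rel T).
Hypotheses (e_sym : symmetric e) (e_irr : irreflexive e).
Implicit Types (A B H : {set T}) (S : {set {set T}}).

Definition boundary A : {set {set T}} :=
  [set [set p.1; p.2] | p : T * T & [&& p.1 \in A, p.2 \notin A & e p.1 p.2]].

Lemma card_boundary A : #|boundary A| = darts e A (~: A).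
Proof.
rewrite card_in_imset => [|[x y] [x' y']] /=.
  rewrite /darts /deg_in pair_big_dep /= -sum1_card big_mkcond [RHS]big_mkcond /=.
  apply: eq_bigr => -[x y] _; rewrite !inE /=.
  by case: (x \in A); case: (y \in A); case: (e x y).
rewrite !inE /= => /and3P[xA yA _] /and3P[x'A y'A _] Exy.
have /set2P[xx'|xy'] : x \in [set x'; y'] by rewrite -Exy set21.
  have /set2P[yx'|->] : y \in [set x'; y'] by rewrite -Exy set22.
    by rewrite yx' x'A in yA.
  by rewrite xx'.
by rewrite -xy' xA in y'A.
Qed.

Lemma mem_boundary A x y : ([set x; y] \in boundary A) =
  [exists p : T * T,
    [&& p.1 \in A, p.2 \notin A, e p.1 p.2 & [set x; y] == [set p.1; p.2]]].
Proof.
apply/imsetP/existsP => -[p].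
  by rewrite inE => /and3P[p1 p2 ep] ->; exists p; rewrite p1 p2 ep eqxx.
by case/and4P=> p1 p2 ep /eqP->; exists p; rewrite // inE p1 p2 ep.
Qed.

Lemma boundary_in A x y : x \in A -> y \in A -> [set x; y] \notin boundary A.
Proof.
move=> xA yA; rewrite mem_boundary negb_exists; apply/forallP => p.
apply/and4P => -[_ p2 _ /eqP Exy]; have : p.2 \in [set x; y] by rewrite Exy set22.
by rewrite !inE => /orP[] /eqP pE; rewrite pE ?xA ?yA in p2.
Qed.

Lemma boundary_out A x y : x \notin A -> y \notin A -> [set x; y] \notin boundary A.
Proof.
move=> xA yA; rewrite mem_boundary negb_exists; apply/forallP => p.
apply/and4P => -[p1 _ _ /eqP Exy]; have : p.1 \in [set x; y] by rewrite Exy set21.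
by rewrite !inE => /orP[] /eqP pE; rewrite -pE p1 in xA yA.
Qed.

Variable S : {set {set T}}.
Local Notation f := (del_edges e S).

Lemma del_edges_sym : symmetric f.
Proof. by move=> x y; rewrite /del_edges /= e_sym setUC. Qed.

Lemma del_edges_cycle c : is_cycle f c -> is_cycle e c.
Proof.
case/and3P=> sc cc Uc; rewrite /is_cycle sc /ucycleb Uc andbT /=.
by apply: sub_cycle cc => x y /andP[].
Qed.

Let f_equiv : {in [set: T] & &, equivalence_rel (connect f)}.
Proof.
move=> x y z _ _ _; split; first exact: connect0.
by move=> xy; apply: (same_connect (sym_connect_sym del_edges_sym) xy).
Qed.

Lemma components_partition : partition (components f) [set: T].
Proof. exact: equivalence_partitionP. Qed.

Lemma components_disjoint A B : A \in components f -> B \in components f ->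
  A != B -> [disjoint A & B].
Proof.
have /and3P[_ /trivIsetP tI _] := components_partition.
exact: tI.
Qed.

Lemma components_closed A x y : A \in components f -> x \in A -> f x y -> y \in A.
Proof.
case/imsetP=> z _ -> ; rewrite !inE /= => zx fxy.
by apply: connect_trans zx _; apply: connect1.
Qed.

Lemma components_neq0 A : A \in components f -> A != set0.
Proof.
by have /and3P[_ _ s0] := components_partition; apply: contraTneq => ->.
Qed.

Lemma boundary_components A : A \in components f -> boundary A \subset S.
Proof.
move=> cA; apply/subsetP => _ /imsetP[[x y]] + ->; rewrite inE /=.
case/and3P=> xA yA exy; apply: contraNT yA => nS.
by apply: (components_closed cA xA); rewrite /del_edges /= exy.
Qed.

Lemma components_cover A B : (forall C, C \in components f -> C = A \/ C = B) ->
  A \in components f -> B \in components f -> A != B -> #|components f| = 2.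
Proof.
move=> AB cA cB nAB.
suff -> : components f = [set A; B] by rewrite cards2 nAB.
apply/setP => C; rewrite !inE; apply/idP/orP => [/AB[]->|[]/eqP->] //; by [left|right].
Qed.

End Components.

(** The successor and the predecessor of [x] on the cycle are distinct and adjacent to [x], so
    degree 2 leaves no room for a chord. *)
Lemma deg2_neighbours (T : finType) (e : rel T) (A : {set T}) (c : seq T) :
  symmetric e -> is_cycle e c -> A = [set x in c] ->
  {in A, forall v, deg_in e A v = 2} ->
  {in A &, forall x y, e x y = (y == next c x) || (x == next c y)}.
Proof.
move=> e_sym /and3P[sc cc Uc] Ac A2 x y; rewrite Ac !inE => xc yc.
have np : next c x != prev c x.
  have [i s cE] := rot_to xc; have Us := Uc; rewrite -(rot_uniq i) cE in Us.
  rewrite -(next_rot i Uc) -(prev_rot i Uc) cE.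
  have : 2 < size (x :: s) by rewrite -cE size_rot.
  case: s Us {cE} => [|a [|b s]] // Us _.
  rewrite /= eqxx; move: Us => /=; rewrite !inE !negb_or.
  case/and4P=> /and3P[xa xb xs] /andP[ab as_] _ _.
  rewrite (negbTE xa) (negbTE xb).
  elim: s b ab {xb} xs as_ => [|w s IH] b ab /=; first by rewrite eqxx.
  by rewrite !inE !negb_or => /andP[/negbTE-> xs] /andP[aw as_]; apply: IH.
have xnE : (x == next c y) = (y == prev c x).
  by apply/eqP/eqP => [->|->]; rewrite ?prev_next ?next_prev.
rewrite xnE; apply/idP/orP => [exy|[]/eqP->]; last first.
- by rewrite e_sym prev_cycle.
- exact: next_cycle.
have sN : [set next c x; prev c x] \subset [set z in A | e x z].
  apply/subsetP => z; rewrite Ac !inE => /orP[]/eqP->.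
    by rewrite mem_next xc next_cycle.
  by rewrite mem_prev xc e_sym prev_cycle.
have /eqP EN : [set next c x; prev c x] == [set z in A | e x z].
  rewrite eqEcard sN cards2 np -(A2 x) ?Ac ?inE // /deg_in -sum1_card.
  rewrite big_mkcond [leqRHS]big_mkcond leq_sum // => z _; rewrite !inE.
  by case: (z \in c); case: (e x z).
have : y \in [set z in A | e x z] by rewrite Ac !inE yc.
by rewrite -EN !inE => /orP[]; [left|right].
Qed.

(** * Edge cuts with at most [(k - 2) * g] edges *)

Section SmallEdgeCuts.
Variables (R : realType) (k g : nat) (T : finType) (e : rel T).
Hypotheses (e_sym : symmetric e) (e_irr : irreflexive e).
Hypotheses (e_reg : regular e k) (girth : forall c, is_cycle e c -> g <= size c).
Hypotheses (k_ge3 : 2 < k) (g_ge5 : 4 < g).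

Local Notation s := ((k - 2) * g).

Hypothesis order : (#|T|%:R < 2 * b2 R k g s)%R.

Variable S : {set {set T}}.
Hypothesis S_leq : #|S| <= s.

Local Notation f := (del_edges e S).

Lemma cut_component_small A : A \in components f -> small_cut e k g A.
Proof.
move=> cA; rewrite (small_cutE _ e_reg) -card_boundary; apply: leq_trans S_leq.
exact/subset_leq_card/boundary_components.
Qed.

Lemma contains_cycle_card A : contains_cycle f A -> g <= #|A|.
Proof.
case=> c cc cA; apply: leq_trans (girth (del_edges_cycle cc)) _.
rewrite cardE; apply: uniq_leq_size => [|x xc]; first by case/and3P: cc.
by rewrite mem_enum cA.
Qed.

Lemma girth_component : cycle_separating e S -> exists A B,
  [/\ A \in components f, B \in components f, A != B, #|A| = g & g <= #|B|].
Proof.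
case=> A [B [cA cB nAB /contains_cycle_card gA /contains_cycle_card gB]].
have dAB := components_disjoint e_sym cA cB nAB.
have [Ag|Bg] := disjoint_small_cuts e_sym e_irr e_reg girth k_ge3 g_ge5 order dAB
  (cut_component_small cA) (cut_component_small cB) gA gB.
  by exists A, B.
by exists B, A; rewrite eq_sym.
Qed.

Section GirthComponent.
Variable A : {set T}.
Hypotheses (cA : A \in components f) (Ag : #|A| = g).

Let A_cut : darts e A (~: A) = s /\ {in A, forall v, deg_in e A v = 2}.
Proof. exact: girth_cut (cut_component_small cA) Ag. Qed.

(** The boundary of [A] lies in [S] and already has [s >= #|S|] edges. *)
Lemma girth_component_boundary : S = boundary e A.
Proof.
apply/esym/eqP; rewrite eqEcard boundary_components // card_boundary.
by case: A_cut => ->.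
Qed.

Lemma girth_component_card : #|S| = s.
Proof. by rewrite girth_component_boundary card_boundary; case: A_cut. Qed.

Lemma girth_component_cycle : induces_cycle f g A.
Proof.
have [_ A2] := A_cut; have fE : {in A &, forall x y, f x y = e x y}.
  move=> x y xA yA; rewrite /del_edges /= girth_component_boundary.
  by rewrite boundary_in ?andbT.
have [||c cc cA'] := induced_has_cycle (H := A) e_irr.
- exact: components_neq0 cA.
- by move=> v /A2->.
have /and3P[sc cyc Uc] := cc.
have cE : A = [set x in c].
  apply/esym/eqP; rewrite eqEcard; apply/andP; split.
    by apply/subsetP => x; rewrite inE => /cA'.
  by rewrite Ag cardsE (card_uniqP Uc) girth.
have cg : size c = g by rewrite -Ag cE cardsE (card_uniqP Uc).
exists c; split=> // [|x y xA yA].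
  rewrite /is_cycle sc /ucycleb Uc andbT /=.
  apply: sub_in_cycle cyc; last by apply/allP => x /cA'; apply.
  by move=> x y xA yA exy; rewrite fE.
by rewrite fE // (deg2_neighbours e_sym cc cE A2).
Qed.

(** Every edge of [S] has an end in [A], so an edge leaving another component must lead into [A]. *)
Lemma deg_in_other C x : C \in components f -> C != A -> x \in C ->
  deg_in e (~: C) x <= deg_in e A x.
Proof.
move=> cC nCA xC; have dCA := components_disjoint e_sym cC cA nCA.
rewrite /deg_in big_mkcond [leqRHS]big_mkcond leq_sum // => y _.
rewrite inE; case: (boolP (y \in C)) => //= yC.
case: (boolP (y \in A)) => // yA; rewrite leqn0 eqb0; apply/negP => exy.
case/negP: yC; apply: (components_closed cC xC); rewrite /del_edges /= exy.
by rewrite girth_component_boundary boundary_out // (disjointFr dCA).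
Qed.

(** Each vertex of [C] has at most one neighbour in [A], hence at least [k - 1 >= 2] in [C]. *)
Lemma card_other C : C \in components f -> C != A -> g <= #|C|.
Proof.
move=> cC nCA; have dCA := components_disjoint e_sym cC cA nCA.
apply: (girth_leq_card e_irr girth); first exact: components_neq0 cC.
move=> x xC; have xA : x \notin A by rewrite (disjointFr dCA).
have := deg_in_other cC nCA xC; have := deg_inC e_reg C x.
have := deg_in_girth e_sym e_irr girth g_ge5 Ag (proj2 A_cut) xA.
by lia.
Qed.

(** All edges leaving [B] or a third component [C] end in [A], so together they number at most [s],
    which [girth_third_part] rules out. *)
Lemma girth_component_other B : B \in components f -> A != B ->
  #|components f| = 2.
Proof.
move=> cB nAB; apply: (components_cover _ cA cB nAB) => C cC.
have [->|nCA] := eqVneq C A; first by left.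
have [->|nCB] := eqVneq C B; first by right.
have [nBA nAC nBC] : [/\ B != A, A != C & B != C].
  by rewrite eq_sym nAB eq_sym nCA eq_sym nCB.
have disj := components_disjoint e_sym.
case: (girth_third_part e_sym e_irr e_reg girth k_ge3 g_ge5 order
  (disj _ _ _ cA cB nAB) (disj _ _ _ cA cC nAC) (disj _ _ _ cB cC nBC)
  Ag (card_other cB nBA) (card_other cC nCA)).
have dle Z : Z \in components f -> Z != A -> darts e Z (~: Z) <= darts e A Z.
  move=> cZ nZA; rewrite (darts_sym e_sym A) leq_sum // => x xZ.
  exact: deg_in_other.
apply: leq_trans (leq_add (dle B cB nBA) (dle C cC nCA)) _.
rewrite -(dartsDr e_sym A (disj _ _ _ cB cC nBC)) -(proj1 A_cut) leq_sum // => x _.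
apply: deg_in_leq; rewrite subUset -!disjoints_subset.
by rewrite (disj _ _ _ cB cA nBA) (disj _ _ _ cC cA nCA).
Qed.

End GirthComponent.
End SmallEdgeCuts.

Local Open Scope ring_scope.

Theorem theorem2 (R : realType) (k g : nat) (T : finType) (e : rel T)
    (hk : (3 <= k)%N) (hg : (5 <= g)%N) (hG : kg_graph e k g)
    (hn : #|T|%:R < 2 * b2 R k g ((k - 2) * g)) :
  cyclically_edge_connected e ((k - 2) * g) /\
  (forall S : {set {set T}},
     edge_cut e S -> cycle_separating e S -> #|S| = ((k - 2) * g)%N ->
     #|components (del_edges e S)| = 2%N /\
     exists2 A : {set T}, A \in components (del_edges e S) &
       induces_cycle (del_edges e S) g A).
Proof.
case: hG => e_sym e_irr e_reg [_ girth]; split=> [S _ sepS|S _ sepS Ss].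
  rewrite leqNgt; apply/negP => Ss; have Sle := ltnW Ss.
  have [A [B [cA _ _ Ag _]]] := girth_component e_sym e_irr e_reg girth hk hg hn Sle sepS.
  by rewrite (girth_component_card e_sym e_irr e_reg girth hk hg Sle cA Ag) ltnn in Ss.
have Sle : (#|S| <= (k - 2) * g)%N by rewrite Ss.
have [A [B [cA cB nAB Ag _]]] := girth_component e_sym e_irr e_reg girth hk hg hn Sle sepS.
split; first exact: (girth_component_other e_sym e_irr e_reg girth hk hg hn Sle cA Ag cB nAB).
by exists A => //; apply: (girth_component_cycle e_sym e_irr e_reg girth hk hg Sle cA Ag).
Qed.
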